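(* There exists an absolute constant $c>0$ such that for every $n\in\mathbb{N}$ and every polytope $P\subset\mathbb{R}^n$ with $B_2^n\subset P\subset\sqrt{n}\,B_2^n$, if $\alpha>0$ is defined by $|\mathcal{F}|=\alpha n$, then $$\log|V|\cdot\log|\mathcal{F}|\ \geq\ c\,n\cdot\frac{\log(\alpha n)}{\log(1+\alpha)},$$ where $V$ is the set of vertices and $\mathcal{F}$ is the set of facets of $P$.
   Context: A polytope in $\mathbb{R}^n$ is the convex hull of finitely many points with non-empty interior. Vertices are its $0$-dimensional faces and facets are its $(n-1)$-dimensional faces. $B_2^n$ is the closed Euclidean unit ball in $\mathbb{R}^n$ centered at the origin. Logarithms are natural. *)

(* Defs.v *)
From mathcomp Require Import all_boot all_order all_algebra.
From mathcomp Require Import finmap.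
From mathcomp Require Import all_classical all_reals all_analysis.

Set Implicit Arguments.
Unset Strict Implicit.
Unset Printing Implicit Defensive.

Import Order.TTheory GRing.Theory Num.Theory.
Import numFieldNormedType.Exports.

Local Open Scope classical_set_scope.
Local Open Scope ring_scope.

Definition dotv (R : realType) (n : nat) (u v : 'rV[R]_n) : R :=
  \sum_(i < n) u 0 i * v 0 i.

(* The library norm on ['rV[R]_n] is the sup norm, so the Euclidean ball
   cannot be written as [closed_ball]. *)
Definition euclidean_ball (R : realType) (n : nat) : set 'rV[R]_n :=
  [set x | Num.sqrt (dotv x x) <= 1].

Definition dilate (R : realType) (n : nat) (r : R) (A : set 'rV[R]_n) :
  set 'rV[R]_n := [set r *: x | x in A].

Definition convex_hull (R : realType) (n : nat) (A : set 'rV[R]_n) :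
  set 'rV[R]_n := smallest (@convex_set R 'rV[R]_n) A.

Definition polytope (R : realType) (n : nat) (P : set 'rV[R]_n) : Prop :=
  (exists s : seq 'rV[R]_n, P = convex_hull [set` s]) /\ interior P !=set0.

Definition affine_set (R : realType) (n : nat) (A : set 'rV[R]_n) : Prop :=
  forall (x y : 'rV[R]_n) (t : R), A x -> A y -> A (t *: x + (1 - t) *: y).

Definition affine_hull (R : realType) (n : nat) (A : set 'rV[R]_n) :
  set 'rV[R]_n := smallest (@affine_set R n) A.

(* The affine hull is a translate of a [d]-dimensional linear subspace; the
   empty set has no dimension. *)
Definition has_dim (R : realType) (n : nat) (A : set 'rV[R]_n) (d : nat) :
  Prop :=
  exists (x : 'rV[R]_n) (U : {vspace 'rV[R]_n}),
    affine_hull A = [set x + u | u in [set` U]] /\ \dim U = d.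

(* [u = 0] is allowed, which yields the improper faces [P] and [set0]. *)
Definition face (R : realType) (n : nat) (P F : set 'rV[R]_n) : Prop :=
  exists (u : 'rV[R]_n) (b : R),
    (forall x, P x -> dotv u x <= b) /\ F = P `&` [set x | dotv u x = b].

Definition faces (R : realType) (n : nat) (P : set 'rV[R]_n) (d : nat) :
  set (set 'rV[R]_n) := [set F | face P F /\ has_dim F d].

(* A vertex [v] is represented by the face [[set v]]. *)
Definition vertices (R : realType) (n : nat) (P : set 'rV[R]_n) :
  set (set 'rV[R]_n) := faces P 0.

(* Only meaningful for [0 < n], as [0.-1 = 0]. *)
Definition facets (R : realType) (n : nat) (P : set 'rV[R]_n) :
  set (set 'rV[R]_n) := faces P n.-1.

(* [fset_set] is empty on infinite sets, so [ncard A = 0] there. *)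
Definition ncard (T : choiceType) (A : set T) : nat := #|` fset_set A|.

(* Main.v *)
Require Import Defs.
From mathcomp Require Import all_boot all_order all_algebra.
From mathcomp Require Import finmap ring lra.
From mathcomp Require Import all_classical all_reals all_analysis.

Set Implicit Arguments.
Unset Strict Implicit.
Unset Printing Implicit Defensive.

Import Order.TTheory GRing.Theory Num.Theory.
Import numFieldNormedType.Exports.

Local Open Scope classical_set_scope.
Local Open Scope ring_scope.

(** Write [N] for the number of facets, [b = 1 + N / n], [L = ln b].  As both
    sides contain the factor [ln N], the claim is [ln |V| >= c n / L]: many
    vertices are needed, because seen from a typical sign vector [e] the
    polytope reaches far while a single vertex does so only for few [e].

    The polytope is the intersection of [N] half-spaces [<a_i, x> <= 1], and
    [|a_i| <= 1] since it contains the unit ball.  Round all [<a_i, e>] to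
    multiples of [T], where [T ^ 2] is a large constant times [L].  By
    subgaussian tails ([card_sgnv_tail], [sum_trunc_sgnv]) almost all rounded
    values are [0], so a typical sign vector has one of so few patterns
    ([card_small_fibers]) that by pigeonhole its pattern is shared by more
    sign vectors than fit in a Hamming ball of radius [n / 4].  Hence there is
    a sign vector [e'] with the same pattern and [<e, e'> <= n / 2]
    ([card_far_partner]); this is the partial colouring method.  Then
    [y = (e - e') / (2 T)] satisfies all constraints, so it lies in the
    polytope, and [<e, y> >= n / (4 T)].

    So a quarter of all sign vectors [e] admit a vertex [v] with
    [<e, v> >= n / (8 T)].  As [|v| <= sqrt n], a given [v] serves at most a
    fraction [exp (- n / (512 T ^ 2))] of them, and the union bound gives
    [4 |V| >= exp (c n / L)] ([size_support_points]).  For bounded [n] the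
    existence of two vertices suffices, because [N >= n] keeps [L] away
    from [0].

    Convex geometry enters through two facts about the hull of a finite set:
    a linear functional comes arbitrarily close to its maximum at some vertex
    ([vertex_near_max], by a generic perturbation of the functional), and a
    point outside the hull violates the inequality of some facet
    ([facet_normal_separation], by Farkas' lemma and the simplex method on the
    polar body). *)

(** * The scalar product *)

Lemma dotvC (R : realType) n (u v : 'rV[R]_n) : dotv u v = dotv v u.
Proof. by apply: eq_bigr => i _; rewrite mulrC. Qed.

Lemma dotvDr (R : realType) n (u v w : 'rV[R]_n) :
  dotv u (v + w) = dotv u v + dotv u w.
Proof. by rewrite /dotv -big_split; apply: eq_bigr => i _; rewrite mxE mulrDr. Qed.

Lemma dotvZr (R : realType) n (u v : 'rV[R]_n) (k : R) :
  dotv u (k *: v) = k * dotv u v.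
Proof.
by rewrite /dotv mulr_sumr; apply: eq_bigr => i _; rewrite mxE mulrCA.
Qed.

Lemma dotvNr (R : realType) n (u v : 'rV[R]_n) : dotv u (- v) = - dotv u v.
Proof. by rewrite -scaleN1r dotvZr mulN1r. Qed.

Lemma dotvBr (R : realType) n (u v w : 'rV[R]_n) :
  dotv u (v - w) = dotv u v - dotv u w.
Proof. by rewrite dotvDr dotvNr. Qed.

Lemma dotvDl (R : realType) n (u v w : 'rV[R]_n) :
  dotv (v + w) u = dotv v u + dotv w u.
Proof. by rewrite !(dotvC _ u) dotvDr. Qed.

Lemma dotvZl (R : realType) n (u v : 'rV[R]_n) (k : R) :
  dotv (k *: u) v = k * dotv u v.
Proof. by rewrite !(dotvC _ v) dotvZr. Qed.

Lemma dotvNl (R : realType) n (u v : 'rV[R]_n) : dotv (- u) v = - dotv u v.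
Proof. by rewrite !(dotvC _ v) dotvNr. Qed.

Lemma dotv0r (R : realType) n (u : 'rV[R]_n) : dotv u 0 = 0.
Proof. by rewrite -(scale0r 0) dotvZr mul0r. Qed.

Lemma dotv_ge0 (R : realType) n (u : 'rV[R]_n) : 0 <= dotv u u.
Proof. by apply: sumr_ge0 => i _; rewrite -expr2 sqr_ge0. Qed.

Lemma dotv_eq0 (R : realType) n (u : 'rV[R]_n) : (dotv u u == 0) = (u == 0).
Proof.
apply/idP/eqP => [|->]; last by rewrite dotv0r.
rewrite psumr_eq0 => [/allP u0|i _]; last by rewrite -expr2 sqr_ge0.
apply/rowP => i; rewrite mxE; apply/eqP; rewrite -sqrf_eq0 expr2.
by apply: u0; rewrite mem_index_enum.
Qed.

(** * Sign vectors and exponential moments *)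

Definition sgnv (R : realType) n (e : {ffun 'I_n -> bool}) : 'rV[R]_n :=
  \row_i (-1) ^+ e i.

Lemma dotv_sgnv (R : realType) n (e : {ffun 'I_n -> bool}) :
  dotv (sgnv R e) (sgnv R e) = n%:R.
Proof.
rewrite /dotv (eq_bigr (fun=> 1)) ?sumr_const ?card_ord // => i _.
by rewrite !mxE -expr2 sqrr_sign.
Qed.

Lemma card_signs (R : realType) n :
  #|{ffun 'I_n -> bool}|%:R = 2 ^+ n :> R.
Proof. by rewrite card_ffun card_bool card_ord natrX. Qed.

(** For [x ^ 2 <= 1 / 2] the bounds [1 - x <= expR (- x)] and
    [1 + x <= expR x] invert to [expR x + expR (- x) <= 2 / (1 - x ^ 2)]; for
    larger [x] already [|x| <= 2 * x ^ 2]. *)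
Lemma expR_addN_le (R : realType) (x : R) :
  expR x + expR (- x) <= 2 * expR (2 * x ^+ 2).
Proof.
have [x2|x2] := leP (x ^+ 2) (1 / 2).
  have p1 := expR_ge1Dx x; have q1 := expR_ge1Dx (- x).
  have pq : expR x * expR (- x) = 1 by rewrite -expRD subrr expR0.
  have hr := expR_ge1Dx (2 * x ^+ 2).
  have xl : -1 < x < 1 by nra.
  have p0 := expR_gt0 x; have q0 := expR_gt0 (- x).
  have h1 : (1 - x) * expR x <= 1 by nra.
  have h2 : (1 + x) * expR (- x) <= 1 by nra.
  have h3 : (1 - x ^+ 2) * (expR x + expR (- x)) <= 2.
    have -> : (1 - x ^+ 2) * (expR x + expR (- x)) =
      (1 + x) * ((1 - x) * expR x) + (1 - x) * ((1 + x) * expR (- x)) by ring.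
    by nra.
  have h4 : expR x + expR (- x) <= 2 * (1 + 2 * x ^+ 2).
    rewrite -(@ler_pM2l _ (1 - x ^+ 2)); last by nra.
    apply: (le_trans h3); have := sqr_ge0 x.
    set y := x ^+ 2; rewrite -/y in x2 *; nra.
  by lra.
have hx (y : R) : y ^+ 2 = x ^+ 2 -> expR y <= expR (2 * x ^+ 2).
  by move=> yx; rewrite ler_expR; nra.
have := hx x erefl; have := hx (- x) (sqrrN x); lra.
Qed.

Lemma sum_expR_sgnv (R : realType) n (a : 'rV[R]_n) :
  \sum_(e : {ffun 'I_n -> bool}) expR (dotv a (sgnv R e)) <=
  2 ^+ n * expR (2 * dotv a a).
Proof.
have -> : \sum_(e : {ffun 'I_n -> bool}) expR (dotv a (sgnv R e)) =
    \prod_i \sum_(b : bool) expR (a 0 i * (-1) ^+ b).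
  rewrite bigA_distr_bigA; apply: eq_bigr => e _; rewrite /dotv expR_sum.
  by apply: eq_bigr => i _; rewrite mxE.
rewrite /dotv mulr_sumr expR_sum.
have -> : 2 ^+ n = \prod_(i < n) (2 : R) by rewrite prodr_const card_ord.
rewrite -big_split /=; apply: ler_prod => i _.
rewrite big_bool /= expr1 expr0 mulr1 mulrN1 addrC.
by rewrite addr_ge0 ?expR_ge0 //= -expr2 expR_addN_le.
Qed.

(** The exponential Markov inequality at the optimal parameter. *)
Lemma card_sgnv_tail (R : realType) n (a : 'rV[R]_n) (A s : R) :
  0 < A -> 0 <= s -> dotv a a <= A ->
  #|[pred e : {ffun 'I_n -> bool} | s <= dotv a (sgnv R e)]|%:R <=
  2 ^+ n * expR (- (s ^+ 2 / (8 * A))).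
Proof.
move=> A0 s0 aA; pose l := s / (4 * A).
have l0 : 0 <= l by rewrite divr_ge0 //; lra.
rewrite -(@ler_pM2r _ (expR (l * s))) ?expR_gt0 // -[leRHS]mulrA -expRD.
have -> : - (s ^+ 2 / (8 * A)) + l * s = 2 * (l ^+ 2 * A).
  by rewrite /l; field; lra.
apply: (@le_trans _ _ (2 ^+ n * expR (2 * dotv (l *: a) (l *: a)))); last first.
  rewrite ler_pM2l ?exprn_gt0 // ler_expR ler_pM2l // dotvZl dotvZr mulrA -expr2.
  by rewrite ler_wpM2l ?sqr_ge0.
apply: le_trans (sum_expR_sgnv _).
rewrite -sum1_card natr_sum mulr_suml.
rewrite [leRHS](bigID [pred e : {ffun 'I_n -> bool} | s <= dotv a (sgnv R e)]) /=.
rewrite -[leLHS]addr0 lerD //; last by apply: sumr_ge0 => e _; rewrite expR_ge0.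
apply: ler_sum => e se; rewrite mul1r ler_expR dotvZl ler_wpM2l //.
Qed.

(** For [T >= 2] the truncated quotient [trunc (x / T)] lies below the
    exponential [expR (T / 4 * (x - T))], whose mean over signs is bounded by
    the exponential moment. *)
Lemma sum_trunc_sgnv (R : realType) n (a : 'rV[R]_n) (T : R) :
  2 <= T -> dotv a a <= 1 ->
  \sum_(e : {ffun 'I_n -> bool}) (Num.trunc (dotv a (sgnv R e) / T))%:R <=
  2 ^+ n * expR (- (T ^+ 2 / 8)).
Proof.
move=> T2 a1; pose l := T / 4.
have T0 : 0 < T by lra.
have step (x : R) : (Num.trunc (x / T))%:R <= expR (- (l * T)) * expR (l * x).
  rewrite -expRD; have [xT|xT] := ltP x T.
    have -> : Num.trunc (x / T) = 0%N.
      by apply/truncn0Pn; rewrite -ltNge ltr_pdivrMr // mul1r.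
    exact: expR_ge0.
  have xT0 : 0 <= x / T by rewrite divr_ge0; lra.
  apply: (@le_trans _ _ (x / T)); first by rewrite truncn_le.
  apply: (@le_trans _ _ (expR (x / T - 1))).
    by have := expR_ge1Dx (x / T - 1); lra.
  rewrite ler_expR /l -(@ler_pM2r _ (4 * T)); last by lra.
  have -> : (x / T - 1) * (4 * T) = 4 * (x - T) by field; lra.
  have -> : (- (T / 4 * T) + T / 4 * x) * (4 * T) = T ^+ 2 * (x - T) by field.
  by apply: ler_wpM2r; nra.
apply: (le_trans (ler_sum _ (fun e _ => step (dotv a (sgnv R e))))).
rewrite -mulr_sumr.
under eq_bigr => e _ do rewrite -dotvZl.
apply: (le_trans (ler_wpM2l (expR_ge0 _) (sum_expR_sgnv _))).
rewrite mulrCA ler_pM2l ?exprn_gt0 // -expRD ler_expR dotvZl dotvZr.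
have h : 0 <= (1 - dotv a a) * l ^+ 2 by rewrite mulr_ge0 ?sqr_ge0; lra.
rewrite /l in h *; lra.
Qed.

(** * Sign vectors with a common rounding pattern *)

Definition fiber (E I : finType) (k : E -> I -> nat) (e : E) : pred E :=
  [pred e' | [forall i, k e' i == k e i]].

(** Give a point with marks [k] the weight [expR (- w * \sum_i k i)].  It is at
    least [expR (- w * m)] when the marks sum to at most [m], whereas the
    weights of all possible tuples of marks add up to the [#|I|]-th power of a
    geometric series, at most [expR (2 * z * #|I|)]. *)
Lemma card_small_fibers (R : realType) (E I : finType) (k : E -> I -> nat)
    (w s m z : R) :
  0 <= w -> expR (- w) <= z -> z <= 1 / 2 -> 0 <= s ->
  #|[pred e | (#|fiber k e|%:R <= s) &&
              ((\sum_i k e i)%:R <= m)]|%:R <=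
  s * expR (w * m + 2 * z * #|I|%:R).
Proof.
move=> w0 zw z2 s0.
pose M := (\max_e \max_i k e i)%N.
have kM e i : (k e i < M.+1)%N.
  by rewrite ltnS /M; apply: leq_trans (leq_bigmax e); apply: leq_bigmax.
pose p e : {ffun I -> 'I_M.+1} := [ffun i => inord (k e i)].
have pE e e' : (p e' == p e) = (e' \in fiber k e).
  rewrite inE; apply/eqP/forallP => [/ffunP pe i|pe].
    have := pe i; rewrite !ffunE => /(congr1 (@nat_of_ord _)).
    by rewrite !inordK // => ->.
  by apply/ffunP => i; rewrite !ffunE (eqP (pe i)).
pose small := [pred e | #|fiber k e|%:R <= s].
pose Z e := \sum_i k e i.
have geo : \sum_(j < M.+1) expR (- (w * j%:R)) <= expR (2 * z).
  have zg : 0 < expR (- w) := expR_gt0 _.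
  have -> : \sum_(j < M.+1) expR (- (w * j%:R)) = \sum_(j < M.+1) expR (- w) ^+ j.
    by apply: eq_bigr => j _; rewrite -expRM_natr mulNr.
  apply: (@le_trans _ _ (1 + 2 * z)); last exact: expR_ge1Dx.
  have := subrX1 (expR (- w)) M.+1; set S := \sum_(j < _) _.
  have : 0 < expR (- w) ^+ M.+1 by rewrite exprn_gt0.
  set q := expR (- w) in zg zw *; nra.
have fib (b : {ffun I -> 'I_M.+1}) :
    \sum_(e | small e && (p e == b)) expR (- (w * (Z e)%:R)) <=
    s * \prod_i expR (- (w * (b i)%:R)).
  have [e0 /andP[se0 /eqP pe0]|none] :=
    pickP (fun e => small e && (p e == b)); last first.
    rewrite [leLHS]big_pred0; last exact: none.
    rewrite mulr_ge0 //; apply: prodr_ge0 => i _; exact: expR_ge0.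
  have -> : \prod_i expR (- (w * (b i)%:R)) = expR (- (w * (Z e0)%:R)).
    rewrite -expR_sum; congr expR; rewrite sumrN natr_sum mulr_sumr; congr (- _).
    by apply: eq_bigr => i _; rewrite -pe0 ffunE inordK.
  rewrite (eq_bigr (fun=> expR (- (w * (Z e0)%:R)))); last first.
    move=> e /andP[_]; rewrite -pe0 pE inE => /forallP h.
    by congr (expR (- (w * _%:R))); apply: eq_bigr => i _; exact/eqP.
  rewrite sumr_const -[leLHS]mulr_natl ler_wpM2r ?expR_ge0 //.
  apply: le_trans se0; rewrite ler_nat; apply: subset_leq_card.
  by apply/fintype.subsetP => e /andP[_]; rewrite -pe0 pE.
rewrite -(@ler_pM2r _ (expR (- (w * m)))) ?expR_gt0 // -[leRHS]mulrA -expRD.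
rewrite addrAC subrr add0r -sum1_card natr_sum mulr_suml.
apply: (@le_trans _ _ (\sum_(e | small e) expR (- (w * (Z e)%:R)))).
  rewrite [leRHS](bigID (fun e => (Z e)%:R <= m)) /= -[leLHS]addr0 lerD //.
    apply: ler_sum => e /andP[_ em]; rewrite mul1r ler_expR lerN2.
    exact: ler_wpM2l.
  by apply: sumr_ge0 => e _; exact: expR_ge0.
rewrite (partition_big p xpredT) //=.
apply: (le_trans (ler_sum _ (fun b _ => fib b))).
rewrite -mulr_sumr ler_wpM2l //.
rewrite -(bigA_distr_bigA (fun (_ : I) (j : 'I_M.+1) => expR (- (w * j%:R)))) /=.
rewrite prodr_const expRM_natr lerXn2r // nnegrE ?expR_ge0 //.
by apply: sumr_ge0 => j _; exact: expR_ge0.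
Qed.

Lemma markov_count (R : realType) (E : finType) (f : E -> R) (m : R) :
  0 < m -> (forall e, 0 <= f e) ->
  #|[pred e | m < f e]|%:R <= (\sum_e f e) / m.
Proof.
move=> m0 f0; rewrite ler_pdivlMr // -sum1_card natr_sum mulr_suml.
rewrite [leRHS](bigID (fun e => m < f e)) /= -[leLHS]addr0 lerD //.
  by apply: ler_sum => e; rewrite mul1r inE => /ltW.
exact: sumr_ge0.
Qed.

(** Pigeonhole.  At most half of the sign vectors have marks with sum above
    [m], and at most a quarter have a smaller sum and a small fibre.  The
    remaining ones share their pattern with more sign vectors than lie in a
    Hamming ball of radius [n / 4], hence with one outside that ball. *)
Lemma card_far_partner (R : realType) n (I : finType) (a : I -> 'rV[R]_n)
    (T w m z : R) :
  (forall i, dotv (a i) (a i) <= 1) -> 2 <= T -> (128 <= n)%N ->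
  0 < m -> #|I|%:R * expR (- (T ^+ 2 / 8)) <= m / 2 ->
  0 <= w -> expR (- w) <= z -> z <= 1 / 2 ->
  w * m + 2 * z * #|I|%:R <= n%:R / 64 ->
  2 ^+ n / 4 <=
  #|[pred e : {ffun 'I_n -> bool} |
      [exists e' : {ffun 'I_n -> bool},
        [forall i, Num.trunc (dotv (a i) (sgnv R e') / T) ==
                   Num.trunc (dotv (a i) (sgnv R e) / T)] &&
        (dotv (sgnv R e) (sgnv R e') <= n%:R / 2)]]|%:R :> R.
Proof.
move=> a1 T2 n128 m0 Im w0 zw z2 small.
pose k (e : {ffun 'I_n -> bool}) i := Num.trunc (dotv (a i) (sgnv R e) / T).
(* By [card_sgnv_tail], no Hamming ball of radius [n / 4] has more points. *)
pose s : R := 2 ^+ n * expR (- (n%:R / 32)).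
have n0 : 0 < n%:R :> R by rewrite ltr0n; apply: leq_trans n128.
have s0 : 0 <= s by rewrite mulr_ge0 ?expR_ge0 ?exprn_ge0.
set G := (X in #|X|%:R).
pose B1 := [pred e | m < (\sum_i k e i)%:R].
pose B2 := [pred e | (#|fiber k e|%:R <= s) && ((\sum_i k e i)%:R <= m)].
have cov : (#|{ffun 'I_n -> bool}| <= #|G| + (#|B1| + #|B2|))%N.
  apply: (@leq_trans #|[predU G & [predU B1 & B2]]|); last first.
    apply: leq_trans (leq_add (leqnn _) (_ : #|[predU B1 & B2]| <= _)%N).
      by rewrite -cardUI leq_addr.
    by rewrite -cardUI leq_addr.
  apply: subset_leq_card; apply/fintype.subsetP => e _; rewrite !inE.
  have [em|em] := ltP m; first by rewrite orbT.
  have [es|es] := leP _ s; first by rewrite !orbT.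
  rewrite orbF; apply/existsP.
  pose near := [pred e' : {ffun 'I_n -> bool} |
    n%:R / 2 <= dotv (sgnv R e) (sgnv R e')].
  have nearc : #|near|%:R <= s.
    have en : dotv (sgnv R e) (sgnv R e) <= n%:R by rewrite dotv_sgnv.
    have := @card_sgnv_tail R n (sgnv R e) n%:R (n%:R / 2) n0 _ en.
    rewrite /s; have -> : (n%:R / 2) ^+ 2 / (8 * n%:R) = n%:R / 32 :> R.
      by field; rewrite lt0r_neq0.
    by apply; rewrite divr_ge0 // ltW.
  have [e' /andP[e'k e'n]|none] :=
    pickP [pred e' | (e' \in fiber k e) && (e' \notin near)].
    by exists e'; move: e'k e'n; rewrite !inE -ltNge => -> /ltW.
  have : (#|fiber k e| <= #|near|)%N.
    apply: subset_leq_card; apply/fintype.subsetP => e' e'k.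
    by have := none e'; rewrite /= e'k /= => /negbFE.
  by rewrite -(ler_nat R); lra.
have c1 : #|B1|%:R <= 2 ^+ n / 2 :> R.
  apply: (le_trans (markov_count (f := fun e => (\sum_i k e i)%:R) m0 _)) => //.
  rewrite ler_pdivrMr //.
  under eq_bigr => e _ do rewrite natr_sum.
  rewrite exchange_big /=.
  apply: (le_trans (ler_sum _ (fun i _ => sum_trunc_sgnv T2 (a1 i)))).
  rewrite sumr_const -[_ *+ #|_|]mulr_natl mulrCA -[leRHS]mulrA.
  rewrite ler_pM2l ?exprn_gt0 //; rewrite cardT -cardE in Im *; lra.
have c2 : #|B2|%:R <= 2 ^+ n / 4 :> R.
  apply: (le_trans (card_small_fibers k m w0 zw z2 s0)).
  rewrite /s -[leLHS]mulrA; apply: ler_wpM2l; first by rewrite exprn_ge0.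
  rewrite -expRD.
  have h : - (n%:R / 32) + (w * m + 2 * z * #|I|%:R) <= - 2.
    have : 128%:R <= n%:R :> R by rewrite ler_nat.
    by lra.
  apply: (le_trans (_ : _ <= expR (- 2))); first by rewrite ler_expR.
  rewrite expRN lef_pV2 ?posrE ?expR_gt0 //.
  have := expR_ge1Dx (1 : R); have -> : 2 = 1 + 1 :> R by [].
  by rewrite expRD; nra.
move: cov; rewrite -(ler_nat R) !natrD card_signs; lra.
Qed.

(** * Few half-spaces force many support points *)

(** Truncation sends [-T < z < T] to [0] on both sides of the origin, so that
    a common pattern of [x] and [- x] pins [x] down to length [2 * T] there and
    to length [T] elsewhere. *)
Lemma trunc_eq_sub_le (R : realType) (x y T : R) : 0 < T ->
  Num.trunc (x / T) = Num.trunc (y / T) ->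
  Num.trunc (- x / T) = Num.trunc (- y / T) -> x - y <= 2 * T.
Proof.
move=> T0 p q.
have up (z : R) : z < T * (Num.trunc (z / T)).+1%:R.
  by rewrite mulrC -ltr_pdivrMr // truncnS_gt.
have dn (z : R) : 0 <= z -> T * (Num.trunc (z / T))%:R <= z.
  by move=> z0; rewrite mulrC -ler_pdivlMr // truncn_le divr_ge0 // ltW.
have zt (z : R) : z <= 0 -> Num.trunc (z / T) = 0%N.
  move=> z0; apply/truncn0Pn; rewrite -ltNge (le_lt_trans _ ltr01) //.
  by rewrite ler_pdivrMr // mul0r.
have u1 := up x; have u2 := up (- y); rewrite -natr1 in u1; rewrite -natr1 in u2.
have [y0|y0] := leP 0 y.
  by have := dn y y0; rewrite p in u1; lra.
have [x0|x0] := leP x 0.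
  have : 0 <= - x by lra.
  by move/dn; rewrite q; lra.
have py : Num.trunc (y / T) = 0%N by apply: zt; lra.
have qx : Num.trunc (- x / T) = 0%N by apply: zt; lra.
by rewrite p py in u1; rewrite -q qx in u2; lra.
Qed.

Lemma ln_ge_half (R : realType) (b : R) : 2 <= b -> 1 / 2 <= ln b.
Proof.
move=> b2; have b0 : 0 < b by lra.
have := expR_ge1Dx (- ln b); rewrite expRN lnK ?posrE //.
have : b^-1 <= 1 / 2 by rewrite -div1r ler_pdivrMr //; lra.
lra.
Qed.

Lemma card_le_cover (E : finType) (I : Type) (F : I -> pred E) (V : seq I)
    (G : pred E) :
  (forall e, G e -> has (F^~ e) V) -> (#|G| <= \sum_(v <- V) #|F v|)%N.
Proof.
elim: V G => [|v V IH] G GV.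
  by rewrite big_nil leqn0; apply/eqP/eq_card0 => e; apply/negP => /GV.
rewrite big_cons -(cardID (F v) G); apply: leq_add.
  by apply: subset_leq_card; apply/fintype.subsetP => e /andP[].
apply: IH => e /andP[/negPf nv /GV] /=.
by rewrite -[F v e]/(e \in F v) nv.
Qed.

(** Seen from a typical sign vector [e], a body cut out by few half-spaces
    reaches far: the difference of [e] and its far partner, scaled down by
    [2 * T], satisfies all constraints.  Each point of the ball of radius
    [sqrt n] lies that far out for an exponentially small part of the sign
    vectors only. *)
Lemma size_support_points (R : realType) n (I : finType) (a : I -> 'rV[R]_n)
    (V : seq 'rV[R]_n) :
  (128 <= n)%N -> (n <= #|I|)%N -> (forall i, dotv (a i) (a i) <= 1) ->
  (forall v, v \in V -> dotv v v <= n%:R) ->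
  (forall y e r, (forall i, dotv (a i) y <= 1) -> 0 < r ->
     exists2 v, v \in V & dotv e y - r <= dotv e v) ->
  expR (n%:R / (256 * 256 * ln (1 + #|I|%:R / n%:R))) <= 4 * (size V)%:R :> R.
Proof.
move=> n128 nI a1 Vn supp; set b := 1 + _; set L := ln b.
have n0 : 0 < n%:R :> R by rewrite ltr0n (leq_trans _ n128).
have N0 : n%:R <= #|I|%:R :> R by rewrite ler_nat.
have b2 : 2 <= b.
  have : 1 <= #|I|%:R / n%:R :> R by rewrite ler_pdivlMr ?mul1r.
  by rewrite /b; lra.
have b0 : 0 < b by lra.
have L2 : 1 / 2 <= L by exact: ln_ge_half.
have Lb : L <= b by rewrite ltW // ln_sublinear.
(* This [T] makes [expR (- (T ^+ 2 / 8))] equal to [b ^- 16], so that the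
   expected sum of all marks, at most [2 * #|I| / b ^+ 16], is a tiny multiple
   of [n]. *)
pose T := Num.sqrt (128 * L).
have TT : T ^+ 2 = 128 * L by rewrite sqr_sqrtr //; lra.
have T2 : 2 <= T.
  have -> : 2 = Num.sqrt (2 ^+ 2) :> R by rewrite sqrtr_sqr ger0_norm.
  by rewrite ler_sqrt; lra.
have T0 : 0 < T by lra.
pose q := b^-1.
have q0 : 0 < q by rewrite invr_gt0.
have q2 : q <= 1 / 2 by rewrite /q -div1r ler_pdivrMr //; lra.
have bq : b * q = 1 by rewrite divff ?lt0r_neq0.
have qE k : expR (- (k%:R * L)) = q ^+ k.
  by rewrite expRN mulrC expRM_natr lnK ?posrE // -exprVn.
have Nq : #|I|%:R * q <= n%:R.
  have NE : #|I|%:R = n%:R * (b - 1) by rewrite /b; field; rewrite lt0r_neq0.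
  by rewrite NE; nra.
have Lq : L * q <= 1 by rewrite -bq ler_pM2r.
have q14 : q ^+ 14 <= 1 / (64 * 64).
  apply: (@le_trans _ _ ((1 / 2) ^+ 14)); last by lra.
  by rewrite lerXn2r // nnegrE; lra.
have qp k : 0 <= q ^+ k by rewrite exprn_ge0 // ltW.
(* Truncation only detects large positive values, whence the opposites. *)
pose a' (p : I * bool) := if p.2 then - a p.1 else a p.1.
have cI : #|{: I * bool}|%:R = 2 * #|I|%:R :> R.
  by rewrite card_prod card_bool natrM mulrC.
have a'1 p : dotv (a' p) (a' p) <= 1.
  by rewrite /a'; case: ifP => _; rewrite ?dotvNl ?dotvNr ?opprK.
pose m := 4 * #|I|%:R * q ^+ 16.
have N1 : 0 < #|I|%:R :> R by lra.
have m0 : 0 < m by rewrite !mulr_gt0 // exprn_gt0.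
have Im : #|{: I * bool}|%:R * expR (- (T ^+ 2 / 8)) <= m / 2.
  have -> : T ^+ 2 / 8 = 16%:R * L by rewrite TT; field.
  by rewrite qE cI /m; lra.
have qz : q ^+ 15 <= 1 / 2.
  by rewrite exprS; have := qp 14%N; nra.
have small : 15%:R * L * m + 2 * q ^+ 15 * #|{: I * bool}|%:R <= n%:R / 64.
  rewrite cI /m.
  have -> : 15%:R * L * (4 * #|I|%:R * q ^+ 16) + 2 * q ^+ 15 * (2 * #|I|%:R) =
    4 * q ^+ 14 * (#|I|%:R * q) * (15%:R * (L * q) + 1) by ring.
  apply: (@le_trans _ _ (4 * (1 / (64 * 64)) * n%:R * (15%:R * 1 + 1))); last by lra.
  have Lq0 : 0 <= L * q by rewrite mulr_ge0 ?ltW //; lra.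
  apply: ler_pM; [|lra| |lra].
    by rewrite !mulr_ge0 // ltW.
  by apply: ler_pM => //; [rewrite mulr_ge0|rewrite mulr_ge0 // ltW|rewrite ler_pM2l].
have far := @card_far_partner R n _ a' T (15%:R * L) m (q ^+ 15) a'1 T2 n128 m0 Im.
have {far} := far _ _ qz small; rewrite qE lexx.
move=> /(_ _ isT); have -> : 0 <= 15%:R * L by rewrite mulr_ge0 //; lra.
move=> /(_ isT); set G := [pred e | _] => Gge.
pose far v := [pred e : {ffun 'I_n -> bool} | n%:R / (8 * T) <= dotv v (sgnv R e)].
have Gfar : (#|G| <= \sum_(v <- V) #|far v|)%N.
  apply: card_le_cover => e /= /existsP [e' /andP[/forallP ee' ne']].
  pose y := (2 * T)^-1 *: (sgnv R e - sgnv R e').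
  have ay i : dotv (a i) y <= 1.
    rewrite dotvZr dotvBr mulrC ler_pdivrMr ?mulr_gt0 // mul1r.
    have /eqP := ee' (i, true); have /eqP := ee' (i, false).
    by rewrite /a' /= !dotvNl => p p'; apply: trunc_eq_sub_le.
  have [|v vV ve] := supp y (sgnv R e) (n%:R / (8 * T)) ay.
    by rewrite divr_gt0 // mulr_gt0.
  apply/hasP; exists v => //=; rewrite dotvC; apply: le_trans ve.
  rewrite dotvZr dotvBr dotv_sgnv lerBrDr.
  apply: (@le_trans _ _ ((2 * T)^-1 * (n%:R / 2))); last first.
    by rewrite ler_pM2l ?invr_gt0 ?mulr_gt0 //; lra.
  have -> : (2 * T)^-1 * (n%:R / 2) = n%:R / (8 * T) + n%:R / (8 * T) by field; lra.
  by [].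
have tail v : v \in V -> #|far v|%:R <=
    2 ^+ n * expR (- (n%:R / (256 * 256 * L))) :> R.
  move=> /Vn vn; have := @card_sgnv_tail R n v n%:R (n%:R / (8 * T)) n0 _ vn.
  have -> : (n%:R / (8 * T)) ^+ 2 / (8 * n%:R) = n%:R / (256 * 256 * L).
    have -> : L = T ^+ 2 / 128 by rewrite TT; field.
    by field; rewrite !lt0r_neq0.
  by apply; rewrite divr_ge0 ?ltW // mulr_gt0.
have : 2 ^+ n / 4 <= (size V)%:R * (2 ^+ n * expR (- (n%:R / (256 * 256 * L)))).
  apply: (le_trans Gge); apply: (@le_trans _ _ (\sum_(v <- V) #|far v|%:R)).
    by rewrite -natr_sum ler_nat.
  rewrite big_seq; apply: (le_trans (ler_sum _ tail)); rewrite -big_seq.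
  by rewrite big_const_seq count_predT iter_addr_0 [leRHS]mulr_natl.
have p0 : 0 < 2 ^+ n :> R by rewrite exprn_gt0.
rewrite mulrCA ler_pM2l // expRN.
by rewrite -ler_pdivrMr ?invr_gt0 ?expR_gt0 // invrK; lra.
Qed.

(** * Convex hulls of finite sets *)

Lemma convex_setP (R : realType) n (A : set 'rV[R]_n) :
  @convex_set R 'rV[R]_n A <->
  forall (x y : 'rV[R]_n) (t : R), 0 <= t <= 1 -> A x -> A y ->
    A (t *: x + (1 - t) *: y).
Proof.
split=> [cA x y t t01 Ax Ay|cA x y l].
  have := cA x y (Itv01 (andP t01).1 (andP t01).2).
  by rewrite !inE; apply.
rewrite !inE => Ax Ay.
by have := cA x y l%:num _ Ax Ay; apply; rewrite ge0 le1.
Qed.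

Lemma convex_hull_convex (R : realType) n (A : set 'rV[R]_n) :
  @convex_set R 'rV[R]_n (convex_hull A).
Proof.
apply/convex_setP => x y t t01 Ax Ay B [cB AB].
by have /convex_setP := cB; apply => //; [apply: Ax|apply: Ay].
Qed.

Lemma convex_hull_dotv_le (R : realType) n (s : seq 'rV[R]_n) u (b : R) :
  (forall v, v \in s -> dotv u v <= b) ->
  forall x, convex_hull [set` s] x -> dotv u x <= b.
Proof.
move=> sb x hx; apply: (hx [set x | dotv u x <= b]); split; last exact: sb.
apply/convex_setP => y z t /andP[t0 t1] /= yb zb.
by rewrite dotvDr !dotvZr; nra.
Qed.

Lemma convex_sum (R : realType) n (A : set 'rV[R]_n) (s : seq 'rV[R]_n)
    (c : nat -> R) :
  @convex_set R 'rV[R]_n A -> (forall v, v \in s -> A v) ->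
  (forall i, 0 <= c i) -> 0 < \sum_(i < size s) c i ->
  A ((\sum_(i < size s) c i)^-1 *: \sum_(i < size s) c i *: s`_i).
Proof.
move/convex_setP => cA; elim: s c => [|a s IH] c sA c0.
  by rewrite big_ord0 ltxx.
rewrite /= !big_ord_recl /=; set C := \sum_(i < _) _; set X := \sum_(i < _) _.
move=> C0.
have ca : 0 <= c 0%N by [].
have sA' v : v \in s -> A v by move=> vs; apply: sA; rewrite inE vs orbT.
have Cge : 0 <= C by apply: sumr_ge0.
have [CP|CN] := ltP 0 C.
  have -> : (c 0%N + C)^-1 *: (c 0%N *: a + X) =
      (c 0%N / (c 0%N + C)) *: a + (1 - c 0%N / (c 0%N + C)) *: (C^-1 *: X).
    by rewrite scalerDr !scalerA; congr (_ *: _ + _ *: _); field; lra.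
  apply: cA; [|by apply: sA; rewrite mem_head|exact: IH (fun i => c i.+1) _ _ _].
  apply/andP; split; first by rewrite divr_ge0 // ltW.
  by rewrite ler_pdivrMr // mul1r lerDl.
have Cz : C = 0 by lra.
have Xz : X = 0.
  rewrite /X big1 // => i _.
  suff -> : c (bump 0 i) = 0 by rewrite scale0r.
  by move/eqP: Cz; rewrite psumr_eq0 // => /allP /(_ i (mem_index_enum _)) /eqP.
rewrite Cz Xz !addr0 scalerA mulVf ?scale1r; last by lra.
by apply: sA; rewrite mem_head.
Qed.

(** Farkas' lemma by induction on the number of generators.  If the separator
    [u] of the tail fails on the new generator [a], everything is projected
    along [a] to the kernel of [u], where the induction hypothesis applies
    again. *)
Lemma farkas (R : realType) d (s : seq 'rV[R]_d) (x : 'rV[R]_d) :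
  (exists c : nat -> R, (forall i, 0 <= c i) /\
     x = \sum_(i < size s) c i *: s`_i) \/
  (exists u, (forall v, v \in s -> dotv u v <= 0) /\ 0 < dotv u x).
Proof.
have [m] := ubnP (size s); elim: m s x => // m IH [|a s] x.
  move=> _; have [->|x0] := eqVneq x 0.
    by left; exists (fun=> 0); split => //; rewrite big_ord0.
  right; exists x; split => //.
  by rewrite lt_neqAle eq_sym dotv_eq0 x0 dotv_ge0.
rewrite /= ltnS => sm; have [[c [c0 xE]]|[u [us ux]]] := IH s x sm.
  left; exists (fun i => if i is j.+1 then c j else 0); split; first by case.
  by rewrite big_ord_recl scale0r add0r xE.
have [ua|ua] := leP (dotv u a) 0.
  by right; exists u; split => // v /[!inE] /orP[/eqP->|/us].
pose p y := y - (dotv u y / dotv u a) *: a.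
have [|[c [c0 xE]]|[w [ws wx]]] := IH (map p s) (p x); first by rewrite size_map.
  left; rewrite size_map in xE.
  exists (fun i => if i is j.+1 then c j else
    dotv u x / dotv u a - \sum_(j < size s) c j * (dotv u s`_j / dotv u a)).
  split.
    case=> // ; rewrite subr_ge0; apply: (@le_trans _ _ 0); last first.
      by rewrite divr_ge0 ?ltW.
    apply: sumr_le0 => j _; rewrite mulr_ge0_le0 //.
    by rewrite mulr_le0_ge0 ?invr_ge0 ?us ?mem_nth // ltW.
  rewrite big_ord_recl /= scalerBl scaler_suml.
  have {1}-> : x = p x + (dotv u x / dotv u a) *: a by rewrite /p subrK.
  rewrite xE addrC -addrA; congr (_ + _).
  rewrite addrC -sumrB; apply: eq_bigr => j _.
  by rewrite (nth_map 0) // /p scalerBr scalerA.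
right; exists (w - (dotv w a / dotv u a) *: u).
have E y : dotv (w - (dotv w a / dotv u a) *: u) y = dotv w (p y).
  rewrite /p dotvDl dotvNl dotvZl dotvBr dotvZr; field; lra.
split=> [v|]; last by rewrite E.
rewrite inE E => /orP[/eqP->|vs]; last by apply: ws; rewrite map_f.
by rewrite /p divff ?scale1r ?subrr ?dotv0r //; lra.
Qed.

Lemma dotv_row_mx (R : realType) m n (u1 v1 : 'rV[R]_m) (u2 v2 : 'rV[R]_n) :
  dotv (row_mx u1 u2) (row_mx v1 v2) = dotv u1 v1 + dotv u2 v2.
Proof.
rewrite /dotv big_split_ord /=; congr (_ + _); apply: eq_bigr => i _.
  by rewrite !row_mxEl.
by rewrite !row_mxEr.
Qed.

(** Farkas' lemma in homogeneous coordinates: the generators are [(v, 1)]. *)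
Lemma convex_hull_separation (R : realType) n (s : seq 'rV[R]_n) (x : 'rV[R]_n) :
  ~ convex_hull [set` s] x ->
  exists u (b : R), (forall v, v \in s -> dotv u v <= b) /\ b < dotv u x.
Proof.
move=> xs; pose h (v : 'rV[R]_n) : 'rV[R]_(n + 1) := row_mx v (const_mx 1).
have hE (w : 'rV[R]_(n + 1)) v : dotv w (h v) = dotv (lsubmx w) v + rsubmx w 0 0.
  by rewrite -{1}[w]hsubmxK dotv_row_mx /dotv [X in _ + X]big_ord1 !mxE mulr1.
have [[c [c0 xE]]|[w [ws wx]]] := farkas (map h s) (h x); last first.
  exists (lsubmx w), (- rsubmx w 0 0); split => [v vs|].
    by have := ws _ (map_f h vs); rewrite hE; lra.
  by move: wx; rewrite hE; lra.
exfalso; apply: xs; rewrite size_map in xE.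
have c1 : \sum_(i < size s) c i = 1.
  have := congr1 (fun y : 'rV[R]_(n + 1) => rsubmx y 0 0) xE.
  rewrite row_mxKr mxE => ->; rewrite linear_sum summxE; apply: eq_bigr => i _.
  by rewrite (nth_map 0) // linearZ /= row_mxKr !mxE mulr1.
have -> : x = (\sum_(i < size s) c i)^-1 *: \sum_(i < size s) c i *: s`_i.
  rewrite c1 invr1 scale1r.
  have := congr1 (@lsubmx R 1 n 1) xE.
  rewrite row_mxKl => ->; rewrite linear_sum; apply: eq_bigr => i _.
  by rewrite (nth_map 0) // linearZ /= row_mxKl.
apply: convex_sum; rewrite ?c1 //; first exact: convex_hull_convex.
by move=> v vs; apply: sub_gen_smallest.
Qed.

(** * Vertices *)

Lemma convex_hull_dotv_lt (R : realType) n (s : seq 'rV[R]_n) u (b : R) :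
  (forall v, v \in s -> dotv u v < b) ->
  forall x, convex_hull [set` s] x -> dotv u x < b.
Proof.
move=> sb x hx; apply: (hx [set x | dotv u x < b]); split; last exact: sb.
apply/convex_setP => y z t /andP[t0 t1] /= yb zb.
by rewrite dotvDr !dotvZr; have [t2|t2] := leP t (1 / 2); nra.
Qed.

Lemma face_has_dim0 (R : realType) n (v : 'rV[R]_n) : has_dim [set v] 0.
Proof.
exists v, 0%VS; split; last exact: dimv0.
apply/seteqP; split=> x.
  move=> h; exists 0; rewrite ?addr0 /= ?mem0v //.
  apply/esym; apply: (h [set v]); split => // y z t -> ->.
  by rewrite -scalerDl addrC subrK scale1r.
case=> u /=; rewrite memv0 => /eqP -> <- A [_]; rewrite addr0; exact.
Qed.

(** A zero-dimensional face is a single point, and the points of the hull at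
    which a linear functional is maximal include one of the generators. *)
Lemma vertices_sub (R : realType) n (s : seq 'rV[R]_n) :
  vertices (convex_hull [set` s]) `<=` [set [set v] | v in [set` s]].
Proof.
move=> F [[u [b [ub FE]]] [x [U [aff /eqP]]]].
rewrite dimv_eq0 => /eqP U0; rewrite {U}U0 in aff.
have aE : affine_hull F = [set x].
  rewrite aff; apply/seteqP; split=> y.
    by case=> w /=; rewrite memv0 => /eqP -> <-; rewrite addr0.
  by move=> ->; exists 0; rewrite ?addr0 //= mem0v.
have Fx y : F y -> y = x.
  by move=> Fy; have : affine_hull F y by [exact: sub_gen_smallest]; rewrite aE.
have F0 : F !=set0.
  apply/set0P/eqP => F0; have : affine_hull F x by rewrite aE.
  by move/(_ set0); apply; split => //; rewrite F0.
have [y Fy] := F0; have yx := Fx y Fy; subst y.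
have FE' : F = [set x] by apply/seteqP; split => [y /Fx ->|y ->].
have [Px xb] : (convex_hull [set` s] `&` [set x | dotv u x = b]) x by rewrite -FE.
(* If every generator were strictly below the maximum, so would be the hull. *)
have [/hasP [v vs /eqP vb]|/hasPn nv] := boolP (has (fun v => dotv u v == b) s).
  exists v => //; rewrite FE'; congr [set _]; apply: Fx; rewrite FE; split => //.
  exact: sub_gen_smallest.
have : dotv u x < b; last by rewrite xb ltxx.
apply: convex_hull_dotv_lt Px => v vs; rewrite lt_neqAle nv //=.
by apply: ub; exact: sub_gen_smallest.
Qed.

(** The powers start at [1], so that the curve tends to [0] with [t]. *)
Definition moment_curve (R : realType) n (t : R) : 'rV[R]_n :=
  \row_i t ^+ i.+1.

(** Along the curve, [dotv _ d] is a polynomial in [t]; it is nonzero for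
    [d != 0], so only finitely many [t] are excluded. *)
Lemma generic_perturbation (R : realType) n (s : seq 'rV[R]_n) (u : 'rV[R]_n)
    (t1 : R) : 0 < t1 -> 0 \notin s ->
  exists2 t, 0 < t < t1 &
    forall d, d \in s -> dotv (u + moment_curve n t) d != 0.
Proof.
move=> t10 s0.
pose q (d : 'rV[R]_n) : {poly R} :=
  (dotv u d)%:P + 'X * \poly_(i < n) oapp (d 0) 0 (insub i).
have qE d t : (q d).[t] = dotv (u + moment_curve n t) d.
  rewrite !hornerE horner_poly dotvDl; congr (_ + _).
  rewrite /dotv mulr_sumr; apply: eq_bigr => i _.
  by rewrite (valK i) mxE exprS /=; ring.
have q0 d : d \in s -> q d != 0.
  move=> ds; apply: contraNneq s0 => qd; suff <- : d = 0 by [].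
  apply/rowP => i; rewrite mxE.
  have := congr1 (fun p : {poly R} => p`_i.+1) qd.
  by rewrite coefD coefC coefXM coef_poly /= ltn_ord (valK i) coef0 add0r.
pose Q := \prod_(d <- s) q d.
have Q0 : Q != 0 by rewrite prodf_seq_neq0; apply/allP => v /q0.
(* More candidates in [(0, t1)] than [Q] can have roots. *)
pose pts := [seq t1 / (j.+2)%:R | j <- iota 0 (size Q)].
have upts : uniq pts.
  rewrite map_inj_uniq ?iota_uniq // => i j /(mulfI (lt0r_neq0 t10)) /invr_inj /eqP.
  by rewrite eqr_nat => /eqP [].
have [/allP|/allPn [t tp tQ]] := boolP (all (root Q) pts).
  move=> /allP rp; have := max_poly_roots Q0 rp upts.
  by rewrite size_map size_iota ltnn.
exists t.
  case/mapP: tp => j _ ->; rewrite divr_gt0 //= ltr_pdivrMr // ltr_pMr //.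
  by rewrite ltr1n.
move=> d ds; rewrite -qE; apply: contraNneq tQ => qd.
rewrite /Q /root horner_prod prodf_seq_eq0; apply/hasP.
by exists d => //=; rewrite qd.
Qed.

Lemma seq_maximizer (R : realType) (T : eqType) (f : T -> R) (s : seq T) :
  s != [::] -> exists2 v, v \in s & forall w, w \in s -> f w <= f v.
Proof.
elim: s => // a [|b s] IH _.
  by exists a; rewrite ?mem_head // => w /[!inE] /eqP ->.
have [//|v vs vmax] := IH; have [av|va] := leP (f a) (f v).
  exists v; first by rewrite in_cons vs orbT.
  by move=> w; rewrite in_cons => /orP[/eqP->|/vmax].
exists a; rewrite ?mem_head // => w; rewrite in_cons => /orP[/eqP->//|/vmax wv].
exact: le_trans wv (ltW va).
Qed.

Lemma dotv_moment_curve_le (R : realType) n (t : R) (y : 'rV[R]_n) :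
  0 <= t <= 1 -> dotv (moment_curve n t) y <= t * \sum_i `|y 0 i|.
Proof.
case/andP=> t0 t1; rewrite mulr_sumr; apply: ler_sum => i _.
rewrite mxE; apply: (@le_trans _ _ (t ^+ i.+1 * `|y 0 i|)).
  by rewrite ler_wpM2l ?exprn_ge0 // ler_norm.
by rewrite ler_wpM2r // exprS ler_piMr // exprn_ile1.
Qed.

(** For a generic functional near [u] the maximum over the generators is
    attained only once, hence at a vertex; the margin [r] pays for the
    perturbation. *)
Lemma vertex_near_max (R : realType) n (s : seq 'rV[R]_n) u x (r : R) :
  convex_hull [set` s] x -> 0 < r ->
  exists v, [/\ vertices (convex_hull [set` s]) [set v], v \in s &
                dotv u x - r <= dotv u v].
Proof.
move=> Px r0; pose S := \sum_(v <- s) \sum_i `|(v - x) 0 i|.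
pose D := [seq d <- [seq v - w | v <- s, w <- s] | d != 0].
have S0 : 0 <= S by do 2!(apply: sumr_ge0 => ? _).
have t10 : 0 < Num.min 1 (r / (1 + S)) by rewrite lt_min ltr01 divr_gt0 //; lra.
have [|t /andP[t0]] := @generic_perturbation R n D u _ t10.
  by rewrite mem_filter eqxx.
rewrite lt_min ltr_pdivlMr; last by lra.
case/andP=> t1 tS gen; set w := u + moment_curve n t in gen.
have s0 : s != [::].
  apply/eqP => s0; suff : dotv 0 x < 0 by rewrite dotvC dotv0r ltxx.
  by apply: convex_hull_dotv_lt Px => v; rewrite s0.
have [v vs vmax] := seq_maximizer (dotv w) s0.
have vmax' := convex_hull_dotv_le vmax.
exists v; split => //.
  (* [v] alone, together with the points strictly below the maximum, forms a
     convex set containing all generators. *)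
  split; last exact: face_has_dim0.
  exists w, (dotv w v); split; first exact: vmax'.
  apply/seteqP; split => y; first by move=> ->; split => //; exact: sub_gen_smallest.
  case=> Py yv; pose A := [set y | y = v \/ dotv w y < dotv w v].
  suff [//|] : A y by rewrite yv ltxx.
  apply: Py; split.
    apply/convex_setP => y1 y2 l l01 A1 A2.
    have [->|l0] := eqVneq l 0; first by rewrite scale0r subr0 scale1r add0r.
    have [->|l1] := eqVneq l 1; first by rewrite scale1r subrr scale0r addr0.
    have {l0 l1}l01 : 0 < l < 1.
      by case/andP: l01 => ? ?; rewrite !lt_neqAle eq_sym l0 l1; apply/andP.
    case: A1 A2 => [->|A1] [->|A2].
    - by left; rewrite -scalerDl addrC subrK scale1r.
    - by right; rewrite dotvDr !dotvZr; nra.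
    - by right; rewrite dotvDr !dotvZr; nra.
    - by right; rewrite dotvDr !dotvZr; nra.
  move=> z zs; have [->|zv] := eqVneq z v; [by left|right].
  rewrite lt_neqAle vmax // andbT -subr_eq0 -dotvBr gen //.
  by rewrite mem_filter subr_eq0 zv; apply: allpairs_f.
have := vmax' x Px; rewrite /w !dotvDl.
suff : dotv (moment_curve n t) (v - x) <= r by rewrite dotvBr; lra.
apply: le_trans (dotv_moment_curve_le _ _) _; first by rewrite !ltW.
apply: (@le_trans _ _ (t * S)); last by lra.
rewrite ler_pM2l // /S (big_rem v) //= lerDl.
by do 2!(apply: sumr_ge0 => ? _).
Qed.

(** * Facets *)

(** The kernel of the matrix with columns [s] decides: it is nonzero, or the
    transposed matrix has full rank. *)
Lemma orthogonal_or_spanning (R : realType) n (s : seq 'rV[R]_n) :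
  (exists2 w, w != 0 & forall v, v \in s -> dotv w v = 0) \/
  ((n <= size s)%N /\
   forall y, exists c : nat -> R, y = \sum_(j < size s) c j *: s`_j).
Proof.
pose M := \matrix_(i < n, j < size s) s`_j 0 i.
have ME w j : (w *m M) 0 j = dotv w s`_j.
  by rewrite mxE; apply: eq_bigr => i _; rewrite mxE.
have [fM|nM] := boolP (row_free M); [right|left].
  split.
    by move: fM; rewrite -row_leq_rank => /leq_trans; apply; exact: rank_leq_col.
  have fMt : row_full M^T by rewrite /row_full mxrank_tr.
  move=> y; have /submxP [c ->] := submx_full y fMt.
  exists (fun j => oapp (c 0) 0 (insub j)); apply/rowP => i.
  rewrite mxE summxE; apply: eq_bigr => j _.
  by rewrite (valK j) !mxE.
move: nM; rewrite -kermx_eq0 => /rowV0Pn [w /sub_kermxP wM w0]; exists w => // v vs.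
have vi : (index v s < size s)%N by rewrite index_mem.
by have := ME w (Ordinal vi); rewrite wM mxE nth_index.
Qed.

Definition orthv (R : realType) n (w : 'rV[R]_n) : {vspace 'rV[R]_n} :=
  lker (linfun (mulmxr w^T : 'rV[R]_n -> 'M[R]_1)).

Lemma mem_orthv (R : realType) n (w v : 'rV[R]_n) :
  (v \in orthv w) = (dotv w v == 0).
Proof.
have E : (v *m w^T) 0 0 = dotv w v.
  by rewrite mxE dotvC; apply: eq_bigr => i _; rewrite mxE.
rewrite memv_ker lfunE /=; apply/eqP/eqP => [h|h].
  by rewrite -E h mxE.
by apply/matrixP => i j; rewrite !ord1 E h mxE.
Qed.

Lemma dim_orthv (R : realType) n (w : 'rV[R]_n) :
  w != 0 -> \dim (orthv w) = n.-1.
Proof.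
move=> w0; pose f := linfun (mulmxr w^T : 'rV[R]_n -> 'M[R]_1).
have := limg_ker_dim f fullv; rewrite capfv dimvf /dim /= mul1n.
suff -> : \dim (limg f) = 1%N by rewrite addn1 => /(congr1 predn).
apply/eqP; rewrite eqn_leq; apply/andP; split.
  by apply: (leq_trans (dimvS (subvf _))); rewrite dimvf.
rewrite lt0n dimv_eq0; apply: contra_neq w0 => f0.
have : w \in orthv w.
  by rewrite memv_ker -memv0 -f0 memv_img // memvf.
by rewrite mem_orthv dotv_eq0 => /eqP.
Qed.

(** The vertices of the polar body: the second clause says that the generators
    tight at [u] span the whole space. *)
Definition facet_normal (R : realType) n (s : seq 'rV[R]_n) (u : 'rV[R]_n) :=
  (forall v, v \in s -> dotv u v <= 1) /\
  (forall w, (forall v, v \in s -> dotv u v = 1 -> dotv w v = 0) -> w = 0).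

Definition normal_face (R : realType) n (s : seq 'rV[R]_n) (u : 'rV[R]_n) :=
  convex_hull [set` s] `&` [set x | dotv u x = 1].

(** The affine hull of the tight generators is the whole hyperplane
    [dotv u x = 1]: a vector orthogonal to [u] is a combination of tight
    generators with coefficients of sum [0], hence a combination of their
    differences. *)
Lemma facet_normal_facet (R : realType) n (s : seq 'rV[R]_n) u :
  (0 < n)%N -> facet_normal s u -> facets (convex_hull [set` s]) (normal_face s u).
Proof.
move=> n0 [us uw].
split; first by exists u, 1; split => //; apply: convex_hull_dotv_le.
pose t := [seq v <- s | dotv u v == 1].
have tP v : v \in t -> normal_face s u v.
  rewrite mem_filter => /andP[/eqP uv vs]; split => //.
  exact: sub_gen_smallest.
have [[w w0 wt]|[nt tspan]] := orthogonal_or_spanning t.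
  move/eqP: w0; case; apply: uw => v vs uv; apply: wt.
  by rewrite mem_filter uv eqxx.
have [x0 x0t] : exists x0, x0 \in t.
  by exists t`_0; rewrite mem_nth // (leq_trans n0).
have ux0 : dotv u x0 = 1 by case: (tP _ x0t).
have u0 : u != 0.
  apply/eqP => uz; move/eqP: ux0; rewrite uz dotvC dotv0r eq_sym.
  by rewrite oner_eq0.
exists x0, (orthv u); split; last exact: dim_orthv.
apply/seteqP; split.
  apply: smallest_sub => [y z l [a /= ao <-] [b /= bo <-]|y [_ /= uy]].
    exists (l *: a + (1 - l) *: b) => /=; first by rewrite memvD // memvZ.
    rewrite !scalerDr addrACA -scalerDl [l + _]addrC subrK scale1r //.
  exists (y - x0); last by rewrite addrC subrK.
  by rewrite /= mem_orthv dotvBr uy ux0 subrr.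
move=> _ [k /= ko <-] A [Aaff FA].
pose dir y := A (x0 + y).
have dirZ l y : dir y -> dir (l *: y).
  rewrite /dir => Ay; have -> : x0 + l *: y = l *: (x0 + y) + (1 - l) *: x0.
    by rewrite scalerDr scalerBl scale1r addrACA [RHS]addrC addrA subrK addrC.
  by apply: Aaff => //; apply: FA; apply: tP.
(* Affine sets are only closed under combinations of two points, so sums of
   directions are reached through the midpoint. *)
have dirD y z : dir y -> dir z -> dir (y + z).
  move=> Ay Az; have -> : y + z = 2 *: ((1 / 2) *: y + (1 - 1 / 2) *: z).
    rewrite scalerDr !scalerA.
    by congr (_ + _); rewrite -[LHS]scale1r; congr (_ *: _); field.
  apply: dirZ; rewrite /dir.
  have -> : x0 + ((1 / 2) *: y + (1 - 1 / 2) *: z) =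
      (1 / 2) *: (x0 + y) + (1 - 1 / 2) *: (x0 + z).
    by rewrite !scalerDr addrACA -scalerDl [_ + (1 - _)]addrC subrK scale1r.
  exact: Aaff.
have [c kE] := tspan k.
have c0 : \sum_(j < size t) c j = 0.
  move: ko; rewrite mem_orthv kE => /eqP.
  rewrite (big_morph (dotv u) (dotvDr u) (dotv0r u)) => uk0.
  apply: etrans uk0; apply: eq_bigr => j _; rewrite dotvZr.
  by have [_ /= ->] := tP _ (mem_nth 0 (ltn_ord j)); rewrite mulr1.
have -> : k = \sum_(j < size t) c j *: (t`_j - x0).
  under eq_bigr => j _ do rewrite scalerBr.
  by rewrite sumrB -kE -scaler_suml c0 scale0r subr0.
apply: (@big_ind _ dir) => //.
  by rewrite /dir addr0; apply: FA; apply: tP.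
move=> j _; apply: dirZ; rewrite /dir addrC subrK.
by apply: FA; apply: tP; rewrite mem_nth.
Qed.

Lemma normal_face_inj (R : realType) n (s : seq 'rV[R]_n) u u' :
  facet_normal s u -> facet_normal s u' ->
  normal_face s u = normal_face s u' -> u = u'.
Proof.
move=> [_ uw] _ E; apply/eqP; rewrite -subr_eq0; apply/eqP; apply: uw => v vs uv.
have : normal_face s u' v by rewrite -E; split => //; exact: sub_gen_smallest.
by case=> _ /= uv'; rewrite dotvDl dotvNl uv uv' subrr.
Qed.

Lemma euclidean_ballP (R : realType) n (x : 'rV[R]_n) :
  euclidean_ball x <-> dotv x x <= 1.
Proof.
rewrite /euclidean_ball /= -(@ler_sqrt _ (dotv x x) 1) ?ler01 // sqrtr1.
by split.
Qed.

Lemma normalize_in_ball (R : realType) n (w : 'rV[R]_n) :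
  w != 0 -> euclidean_ball ((Num.sqrt (dotv w w))^-1 *: w).
Proof.
move=> w0; apply/euclidean_ballP; rewrite dotvZl dotvZr mulrA -expr2 exprVn.
by rewrite sqr_sqrtr ?dotv_ge0 // mulVf // dotv_eq0.
Qed.

Lemma sqrt_dotv_gt0 (R : realType) n (w : 'rV[R]_n) :
  w != 0 -> 0 < Num.sqrt (dotv w w).
Proof. by move=> w0; rewrite sqrtr_gt0 lt_neqAle eq_sym dotv_eq0 w0 dotv_ge0. Qed.

Lemma dotv_normalize (R : realType) n (w : 'rV[R]_n) :
  w != 0 -> dotv w ((Num.sqrt (dotv w w))^-1 *: w) = Num.sqrt (dotv w w).
Proof.
move=> w0; rewrite dotvZr -[X in _ * X](sqr_sqrtr (dotv_ge0 w)) expr2 mulrA.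
rewrite mulVf ?mul1r //.
by rewrite gt_eqF // sqrt_dotv_gt0.
Qed.

Lemma facet_normal_dotv_le1 (R : realType) n (s : seq 'rV[R]_n) u :
  @euclidean_ball R n `<=` convex_hull [set` s] -> facet_normal s u ->
  dotv u u <= 1.
Proof.
move=> ball [us _]; have [->|u0] := eqVneq u 0; first by rewrite dotv0r ler01.
have := convex_hull_dotv_le us (ball _ (normalize_in_ball u0)).
by rewrite dotv_normalize // -(@ler_sqrt _ (dotv u u) 1) ?ler01 // sqrtr1.
Qed.

(** Linear programming over the polar body: while the tight generators leave a
    direction [w] free, move along it without decreasing the value at [x]
    until a new generator becomes tight.  The ball inside the hull makes every
    such ray leave the polar body. *)
Lemma improve_to_facet_normal (R : realType) n (s : seq 'rV[R]_n) u x :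
  @euclidean_ball R n `<=` convex_hull [set` s] ->
  (forall v, v \in s -> dotv u v <= 1) ->
  exists2 u', facet_normal s u' & dotv u x <= dotv u' x.
Proof.
move=> ball; pose tight u := [seq v <- s | dotv u v == 1].
have [m] := ubnP (n - \dim (span (tight u))); elim: m u => // m IH u dm us.
have [uw|/existsNP [w /not_implyP [wt /eqP w0]]] := pselect
  (forall w, (forall v, v \in s -> dotv u v = 1 -> dotv w v = 0) -> w = 0).
  by exists u; [split|].
wlog wx : w wt w0 / 0 <= dotv w x.
  move=> H; have [|wx] := leP 0 (dotv w x); first exact: H.
  apply: (H (- w)); rewrite ?oppr_eq0 ?dotvNl ?oppr_ge0 1?ltW // => v vs uv.
  by rewrite dotvNl wt // oppr0.
pose t := [seq v <- s | 0 < dotv w v].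
pose f v := - ((1 - dotv u v) / dotv w v).
have t0 : t != [::].
  apply/eqP => t0; have ws v : v \in s -> dotv w v <= 0.
    move=> vs; rewrite leNgt; apply/negP => wv.
    by have : v \in t by [rewrite mem_filter wv]; rewrite t0.
  have := convex_hull_dotv_le ws (ball _ (normalize_in_ball w0)).
  by rewrite dotv_normalize // leNgt sqrt_dotv_gt0.
have [v0 + fmax] := seq_maximizer f t0; rewrite mem_filter => /andP[wv0 v0s].
(* The step after which the first new generator becomes tight. *)
pose l := (1 - dotv u v0) / dotv w v0.
have l0 : 0 <= l by rewrite divr_ge0 ?subr_ge0 ?us // ltW.
have uE v : dotv (u + l *: w) v = dotv u v + l * dotv w v by rewrite dotvDl dotvZl.
have uv0 : dotv (u + l *: w) v0 = 1.
  by rewrite uE /l; field; rewrite lt0r_neq0.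
have us' v : v \in s -> dotv (u + l *: w) v <= 1.
  move=> vs; rewrite uE; have [wv|wv] := ltP 0 (dotv w v).
    have := fmax v; rewrite mem_filter wv vs => /(_ isT).
    by rewrite /f lerN2 -/l ler_pdivlMr //; lra.
  by have := us v vs; nra.
have [|u' nu' xu'] := IH (u + l *: w) _ us'; last first.
  by exists u' => //; apply: le_trans xu'; rewrite uE lerDl mulr_ge0.
rewrite ltnS in dm; apply: leq_trans dm; pose u1 := u + l *: w.
have sub : (span (tight u) <= span (tight u1))%VS.
  apply: sub_span => v; rewrite !mem_filter => /andP[/eqP uv vs].
  by rewrite uE uv wt // mulr0 addr0 eqxx.
have lt : (\dim (span (tight u)) < \dim (span (tight u1)))%N.
  rewrite ltn_neqAle dimvS // andbT; apply/negP => E.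
  have : v0 \in span (tight u).
    have /eqP -> : span (tight u) == span (tight u1).
      by rewrite eqEdim sub (eqP E) /=.
    by apply: memv_span; rewrite mem_filter uv0 eqxx.
  have : (span (tight u) <= orthv w)%VS.
    apply/span_subvP => v; rewrite mem_filter mem_orthv => /andP[/eqP uv vs].
    by rewrite wt.
  move=> /subvP so /so; rewrite mem_orthv => /eqP wz; move: wv0.
  by rewrite wz ltxx.
have : (\dim (span (tight u1)) <= n)%N.
  by apply: (leq_trans (dimvS (subvf _))); rewrite dimvf /dim /= mul1n.
move: lt; set d1 := \dim _; set d2 := \dim _ => lt d2n.
exact: ltn_sub2l (leq_trans lt d2n) lt.
Qed.

(** A separating hyperplane, normalized to the level [1], is a point of the
    polar body, which is then moved to a vertex. *)
Lemma facet_normal_separation (R : realType) n (s : seq 'rV[R]_n) x :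
  @euclidean_ball R n `<=` convex_hull [set` s] ->
  ~ convex_hull [set` s] x -> exists2 u, facet_normal s u & 1 < dotv u x.
Proof.
move=> ball /convex_hull_separation [u [b [ub bx]]].
have b0 : 0 < b.
  have ball0 : 0 <= b.
    rewrite -(dotv0r u); apply: convex_hull_dotv_le ub _ _; apply: ball.
    by apply/euclidean_ballP; rewrite dotv0r ler01.
  have [uz|u0] := eqVneq u 0.
    by move: bx; rewrite uz dotvC dotv0r ltNge ball0.
  have := convex_hull_dotv_le ub (ball _ (normalize_in_ball u0)).
  by rewrite dotv_normalize //; apply: lt_le_trans; exact: sqrt_dotv_gt0.
have [|u' nu' h] := @improve_to_facet_normal R n s (b^-1 *: u) x ball.
  by move=> v vs; rewrite dotvZl mulrC ler_pdivrMr // mul1r ub.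
exists u' => //; apply: lt_le_trans h.
by rewrite dotvZl mulrC ltr_pdivlMr // mul1r.
Qed.

Lemma dilate_ball_dotv (R : realType) n (x : 'rV[R]_n) :
  dilate (Num.sqrt n%:R) (@euclidean_ball R n) x -> dotv x x <= n%:R.
Proof.
case=> y /euclidean_ballP yy <-; rewrite dotvZl dotvZr mulrA -expr2.
by rewrite sqr_sqrtr ?ler0n // ler_piMr ?ler0n.
Qed.

(** A polyhedron cut out by fewer than [n] half-spaces contains a line, so it
    is unbounded. *)
Lemma size_facet_normals (R : realType) n (s D : seq 'rV[R]_n) :
  @euclidean_ball R n `<=` convex_hull [set` s] ->
  (forall x, convex_hull [set` s] x -> dotv x x <= n%:R) ->
  (forall u, facet_normal s u -> u \in D) -> (n <= size D)%N.
Proof.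
move=> ball bnd nD; have [[w w0 wD]|[//]] := orthogonal_or_spanning D.
pose k := n.+1%:R * (Num.sqrt (dotv w w))^-1.
have [|/(facet_normal_separation ball) [u /nD uD]] :=
  pselect (convex_hull [set` s] (k *: w)).
  move/bnd; rewrite dotvZl dotvZr mulrA -expr2 exprMn exprVn.
  rewrite sqr_sqrtr ?dotv_ge0 //.
  rewrite -mulrA mulVf ?dotv_eq0 // mulr1 -natrX ler_nat expnS expn1.
  by rewrite leqNgt (leq_trans _ (leq_pmulr _ _)).
by rewrite dotvZr dotvC wD // mulr0 ltr10.
Qed.

(** A facet normal is determined by its facet, so there are no more normals
    than facets. *)
Lemma finite_facet_normals (R : realType) n (s : seq 'rV[R]_n) :
  (0 < n)%N -> finite_set (facets (convex_hull [set` s])) ->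
  finite_set [set u | facet_normal s u] /\
  (ncard [set u | facet_normal s u] <= ncard (facets (convex_hull [set` s])))%N.
Proof.
move=> n0 ff; set N := [set u | _].
have inj : {in N &, injective (normal_face s)}.
  by move=> u u' /[!inE] nu nu'; exact: normal_face_inj.
have fN : finite_set N.
  rewrite -(eq_finite_set (inj_card_eq inj)); apply: sub_finite_set ff.
  by move=> _ [u nu <-]; exact: facet_normal_facet.
split => //; rewrite /ncard.
have <- : #|` [fset normal_face s u | u in fset_set N]%fset| = #|` fset_set N|.
  rewrite card_in_imfset // => u u' /=; rewrite !in_fset_set //; exact: inj.
apply: fsubset_leq_card; apply/fsubsetP => F /imfsetP [u /=].
rewrite !in_fset_set // !inE => nu ->; exact: facet_normal_facet.
Qed.

Lemma card_vertices_ge (R : realType) n (s V : seq 'rV[R]_n) :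
  uniq V -> (forall v, v \in V -> vertices (convex_hull [set` s]) [set v]) ->
  (size V <= ncard (vertices (convex_hull [set` s])))%N.
Proof.
move=> uV VP.
have fv : finite_set (vertices (convex_hull [set` s])).
  apply: sub_finite_set (@vertices_sub R n s) _; apply: finite_image; exact: finite_seq.
rewrite -(size_map (fun v => [set v])) /ncard; apply: uniq_leq_size.
  by rewrite map_inj_uniq // => u v E; have : [set v] u by rewrite -E.
by move=> F /mapP [v vV ->]; rewrite in_fset_set // inE; exact: VP.
Qed.

(** * Polytopes between concentric balls *)

(** Maximizing opposite coordinate functionals leads to different vertices. *)
Lemma two_vertices (R : realType) n (V : seq 'rV[R]_n) (P : set 'rV[R]_n) :
  (0 < n)%N -> @euclidean_ball R n `<=` P ->
  (forall u x r, P x -> 0 < r -> exists2 v, v \in V & dotv u x - r <= dotv u v) ->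
  (2 <= size V)%N.
Proof.
move=> n0 ball supp; pose u : 'rV[R]_n := delta_mx 0 (Ordinal n0).
have uu : dotv u u = 1.
  rewrite /dotv (bigD1 (Ordinal n0)) //= big1 ?addr0 ?mxE ?eqxx ?mulr1 // => i ni.
  by rewrite mxE (negPf ni) andbF mul0r.
have up : P u by apply: ball; apply/euclidean_ballP; rewrite uu.
have un : P (- u) by apply: ball; apply/euclidean_ballP; rewrite dotvNl dotvNr opprK uu.
have half : 0 < 1 / 2 :> R by [].
have [v vV vu] := supp u u _ up half; have [w wV wu] := supp (- u) (- u) _ un half.
apply: (@uniq_leq_size _ [:: v; w]); last first.
  by move=> x; rewrite !inE => /orP[/eqP->|/eqP->].
rewrite /= !andbT inE; apply/eqP => vw; move: vu wu.
rewrite vw !dotvNl dotvNr uu; lra.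
Qed.

(** The factor [4] in [size_support_points] is absorbed by [2 <= #|V|], which
    costs the factor [3]; the same bound settles the dimensions below [128]. *)
Lemma ln_vertices_ge (R : realType) n (s : seq 'rV[R]_n) :
  let P := convex_hull [set` s] in
  (0 < n)%N -> @euclidean_ball R n `<=` P ->
  P `<=` dilate (Num.sqrt n%:R) (@euclidean_ball R n) ->
  finite_set (facets P) ->
  (n <= ncard (facets P))%N /\
  n%:R / (256 * 256 * 3 * ln (1 + (ncard (facets P))%:R / n%:R)) <=
    ln (ncard (vertices P))%:R :> R.
Proof.
move=> P n0 ball dil ffac.
have bnd x : P x -> dotv x x <= n%:R by move/dil/dilate_ball_dotv.
have [fN cN] := finite_facet_normals n0 ffac.
set N := [set u | facet_normal s u] in fN cN.
pose D := fset_set N.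
have DN u : u \in D -> facet_normal s u by rewrite in_fset_set // inE.
have nD : (n <= #|` D|)%N.
  by apply: size_facet_normals ball bnd _ => u nu; rewrite in_fset_set // inE.
split; first exact: leq_trans cN.
pose V := undup [seq v <- s | `[< vertices P [set v] >]].
have VP v : v \in V -> vertices P [set v].
  by rewrite mem_undup mem_filter => /andP[/asboolP].
have VP' v : v \in V -> P v.
  rewrite mem_undup mem_filter => /andP[_ vs]; exact: sub_gen_smallest.
have supp u x r : P x -> 0 < r -> exists2 v, v \in V & dotv u x - r <= dotv u v.
  move=> Px /(vertex_near_max u Px) [v [vP vs uv]]; exists v => //.
  by rewrite mem_undup mem_filter vs andbT; apply/asboolP.
have V2 := two_vertices n0 ball supp.
have VV := card_vertices_ge (undup_uniq _) VP.
set F := (ncard (facets P))%:R; set b := 1 + F / n%:R.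
have nR : 0 < n%:R :> R by rewrite ltr0n.
have DF : #|` D|%:R <= F by rewrite ler_nat.
pose d : R := 1 + #|` D|%:R / n%:R.
have d2 : 2 <= d.
  have : 1 <= #|` D|%:R / n%:R :> R by rewrite ler_pdivlMr ?mul1r ?ler_nat.
  by rewrite /d; lra.
have db : d <= b by rewrite lerD2l ler_pM2r ?invr_gt0.
have Ld := ln_ge_half d2.
have Ldb : ln d <= ln b by rewrite ler_ln // posrE; lra.
have V1 : 2 <= (size V)%:R :> R by rewrite ler_nat.
have V0 : 0 < (size V)%:R :> R by lra.
have W1 : (size V)%:R <= (ncard (vertices P))%:R :> R by rewrite ler_nat.
have lnV : ln 2 <= ln (size V)%:R :> R by rewrite ler_ln // posrE.
have L2 : 1 / 2 <= ln 2 :> R by exact: ln_ge_half.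
apply: (@le_trans _ _ (ln (size V)%:R)); last first.
  by rewrite ler_ln // posrE //; lra.
apply: (@le_trans _ _ (n%:R / (256 * 256 * 3 * ln d))).
  by rewrite ler_pM2l // lef_pV2 ?posrE ?ler_pM2l ?mulr_gt0 //; lra.
have [n128|n128] := leqP 128 n; last first.
  rewrite ler_pdivrMr ?mulr_gt0 //; last by lra.
  have : n%:R <= 128%:R :> R by rewrite ler_nat ltnW.
  by nra.
have cD : #|{: D}| = #|` D| by rewrite cardfE.
have := @size_support_points R n _ (val : D -> 'rV[R]_n) V n128.
rewrite cD -/d => /(_ nD) key.
have {}key : expR (n%:R / (256 * 256 * ln d)) <= 4 * (size V)%:R :> R.
  apply: key => [i|v /VP' /bnd //|y e r yD r0].
    exact: facet_normal_dotv_le1 ball (DN _ (fsvalP i)).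
  apply: supp => //; apply: contrapT => /(facet_normal_separation ball) [u nu].
  have uD : u \in D by rewrite in_fset_set // inE.
  by rewrite ltNge (yD [` uD]%fset).
have : n%:R / (256 * 256 * ln d) <= 2 * ln 2 + ln (size V)%:R.
  rewrite -[leLHS]expRK (_ : 2 * ln 2 + _ = ln (4 * (size V)%:R)).
    by rewrite ler_ln // posrE ?expR_gt0 // mulr_gt0.
  by rewrite lnM ?posrE // (_ : 4 = 2 ^+ 2) ?lnXn // ?mulr_natl //; lra.
have -> : n%:R / (256 * 256 * 3 * ln d) = n%:R / (256 * 256 * ln d) / 3.
  by field; rewrite gt_eqF //; lra.
lra.
Qed.

Theorem corollary3p3 (R : realType) :
  exists c : R, 0 < c /\
    forall (n : nat) (P : set 'rV[R]_n) (alpha : R),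
      polytope P ->
      @euclidean_ball R n `<=` P ->
      P `<=` dilate (Num.sqrt n%:R) (@euclidean_ball R n) ->
      0 < alpha ->
      (ncard (facets P))%:R = alpha * n%:R ->
      ln (ncard (vertices P))%:R * ln (ncard (facets P))%:R
        >= c * n%:R * (ln (alpha * n%:R) / ln (1 + alpha)).
Proof.
exists (1 / (256 * 256 * 3)); split; first by rewrite divr_gt0 // !mulr_gt0.
move=> n _ alpha [[s ->] _] ball dil a0 Fa; set P := convex_hull _ in ball dil Fa *.
(* In dimension [0] both sides vanish. *)
case: n => [|n] in s P alpha ball dil a0 Fa *.
  by rewrite Fa !mulr0 mul0r (ln0 (lexx 0)) mulr0.
have n0 : 0 < n.+1%:R :> R by rewrite ltr0Sn.
have ffac : finite_set (facets P).
  (* [ncard] is [0] on infinite sets. *)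
  apply: contrapT => inf; have : 0 < alpha * n.+1%:R by rewrite mulr_gt0.
  by rewrite -Fa /ncard /fset_set; case: pselect => //=; rewrite ltxx.
have [nF lnV] := ln_vertices_ge (ltn0Sn n) ball dil ffac.
have aE : alpha = (ncard (facets P))%:R / n.+1%:R by rewrite Fa mulfK ?lt0r_neq0.
rewrite -aE in lnV; rewrite -Fa.
have F0 : 0 <= ln (ncard (facets P))%:R :> R.
  by rewrite ln_ge0 // ler1n (leq_trans _ nF).
apply: le_trans (ler_wpM2r F0 lnV).
rewrite le_eqVlt; apply/orP; left; apply/eqP; field.
by rewrite gt_eqF // ln_gt0 // ltrDl.
Qed.
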